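(* Let $(X,\rho_X)$ and $(Y,\rho_Y)$ be compact metric spaces, let $\rho$ be a metric on the disjoint union $Z=X\,\dot\cup\,Y$ whose restrictions to $X$ and $Y$ are $\rho_X$ and $\rho_Y$, and suppose that $\mathrm{dist}_H^{\rho}(X,Y)<\varepsilon$. Let $\mathcal A$ and $\mathcal D$ be the algebras of Lipschitz functions on $X$ and $Y$, and let $n$ be a positive integer. (a) Let $p\in M_n(\mathcal A)$ and $q\in M_n(\mathcal D)$ be projections, and suppose that $\varepsilon L(p\oplus q)<1/2$. If $q_1$ is any other projection in $M_n(\mathcal D)$ such that $\varepsilon L(p\oplus q_1)<1/2$, then there is a path $t\mapsto q_t$ through projections in $M_n(\mathcal D)$, going from $q$ to $q_1$, such that $$L(p\oplus q_t)\le (1-\delta)^{-1}\max\{L(p\oplus q),\,L(p\oplus q_1)\}$$ for all $t$, where $\delta=\varepsilon\bigl(L(p\oplus q)+L(p\oplus q_1)\bigr)$. If instead there is a projection $p_1\in M_n(\mathcal A)$ such that $\varepsilon L(p_1\oplus q)<1/2$, then there is a path $t\mapsto p_t$ through projections in $M_n(\mathcal A)$, going from $p$ to $p_1$, such that $$L(p_t\oplus q)\le (1-\delta')^{-1}\max\{L(p\oplus q),\,L(p_1\oplus q)\}$$ for all $t$, where $\delta'=\varepsilon\bigl(L(p\oplus q)+L(p_1\oplus q)\bigr)$. (b) Let $p_0$ and $p_1$ be projections in $M_n(\mathcal A)$ and let $q_0$ and $q_1$ be projections in $M_n(\mathcal D)$. Set $$\delta=\|p_0-p_1\|+\varepsilon\bigl(L(p_0\oplus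 q_0)+L(p_1\oplus q_1)\bigr).$$ If $\delta<1$, then there are continuous paths of projections $t\mapsto p_t$ in $M_n(\mathcal A)$ and $t\mapsto q_t$ in $M_n(\mathcal D)$, from $p_0$ to $p_1$ and from $q_0$ to $q_1$ respectively, such that $$L(p_t\oplus q_t)\le (1-\delta)^{-1}\max\{L(p_0\oplus q_0),\,L(p_1\oplus q_1)\}$$ for all $t$. The same statements hold with real-valued functions in place of complex-valued functions throughout.
   Context: For a compact metric space $(W,\rho)$ let $C(W)$ be the algebra of continuous complex-valued functions. $M_n(C(W))$ is viewed as the algebra of continuous functions from $W$ to $M_n(\mathbb C)$, where $M_n(\mathbb C)$ carries the operator norm for its action on the Hilbert space $\mathbb C^n$, with norm $\|a\|=\sup_{w}\|a(w)\|$ and pointwise adjoint. For $a\in M_n(C(W))$, $L(a)=L^\rho(a)=\sup\{\|a(x)-a(y)\|/\rho(x,y): x,y\in W,\ x\ne y\}\in[0,\infty]$. The Lipschitz functions on $W$ are those $f \in C(W)$ with $L(f)<\infty$; $M_n$ of the algebra of Lipschitz functions is $\{a\in M_n(C(W)):L(a)<\infty\}$. A projection is an element $p$ with $p=p^2=p^*$. For $Z=X\,\dot\cup\,Y$ we have $C(Z)=C(X)\oplus C(Y)$; $p\oplus q$ denotes the function on $Z$ equal to $p$ on $X$ and $q$ on $Y$, and $L(p\oplus q)$ is computed with $\rho$ on $Z$. $\mathrm{dist}_H^\rho(X,Y)$ is the Hausdorff distance between $X$ and $Y$ as subsets of $(Z,\rho)$. A path is a norm-continuous function with domain $[0,1]$.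 *)

(* Defs.v *)
From HB Require Import structures.
From mathcomp Require Import all_boot all_order all_algebra.
From mathcomp Require Import all_classical all_reals all_analysis.
From mathcomp Require Import complex.

Set Implicit Arguments.
Unset Strict Implicit.
Unset Printing Implicit Defensive.

Import Order.TTheory GRing.Theory Num.Theory.
Import numFieldNormedType.Exports.

Local Open Scope classical_set_scope.
Local Open Scope ring_scope.

(* Functions are complex-valued or real-valued throughout; quantifying over
   this index treats both cases with a single set of definitions. *)
Inductive scalar_kind := ComplexScalars | RealScalars.

Definition scalar_type (R : realType) (k : scalar_kind) : numFieldType :=
  match k with ComplexScalars => R[i] | RealScalars => R end.

Definition scalar_conj (R : realType) (k : scalar_kind) :
    scalar_type R k -> scalar_type R k :=
  match k with ComplexScalars => @conjc R | RealScalars => id end.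

Definition scalar_abs (R : realType) (k : scalar_kind) : scalar_type R k -> R :=
  match k with
  | ComplexScalars => @ComplexField.Normc.normc R
  | RealScalars => fun x : R => `|x|
  end.

Section MatrixFunctions.
Context {R : realType} {k : scalar_kind} {n : nat}.

Definition adjoint (A : 'M[scalar_type R k]_n) : 'M[scalar_type R k]_n :=
  map_mx (@scalar_conj R k) A^T.

Definition hilbert_norm (v : 'cV[scalar_type R k]_n) : R :=
  Num.sqrt (\sum_(i < n) scalar_abs (v i ord0) ^+ 2).

Definition opnorm (A : 'M[scalar_type R k]_n) : R :=
  sup [set hilbert_norm (A *m v) | v in [set v | hilbert_norm v <= 1]].

(* Both suprema below are taken in [0, +oo], where the supremum of the empty
   set is 0; this is why 0 is adjoined. *)
Definition cnorm (W : Type) (a : W -> 'M[scalar_type R k]_n) : \bar R :=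
  ereal_sup ([set 0%E] `|` [set (opnorm (a w))%:E | w in [set: W]]).

Definition Lip (W : Type) (rho : W -> W -> R) (a : W -> 'M[scalar_type R k]_n) :
    \bar R :=
  ereal_sup ([set 0%E] `|`
    [set (opnorm (a z.1 - a z.2) / rho z.1 z.2)%:E
       | z in [set z : W * W | z.1 <> z.2]]).

Definition opnorm_continuous (W : topologicalType)
    (a : W -> 'M[scalar_type R k]_n) : Prop :=
  forall w : W, opnorm (a v - a w) @[v --> w] --> (0 : R).

Definition projection (W : Type) (p : W -> 'M[scalar_type R k]_n) : Prop :=
  forall w, p w *m p w = p w /\ adjoint (p w) = p w.

Definition lipschitz_projection (W : metricType R)
    (p : W -> 'M[scalar_type R k]_n) : Prop :=
  [/\ opnorm_continuous p, (Lip (@mdist R W) p < +oo)%E & projection p].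

(* The values of [r] outside of the unit interval are irrelevant. *)
Definition projection_path (W : metricType R)
    (r : R -> W -> 'M[scalar_type R k]_n) (p p' : W -> 'M[scalar_type R k]_n) : Prop :=
  [/\ r 0 = p, r 1 = p',
      forall t : R, 0 <= t <= 1 -> lipschitz_projection (r t) &
      forall t : R, 0 <= t <= 1 ->
        cnorm (r s \- r t) @[s --> within `[0, 1] (nbhs t)] --> 0%E].

Definition dsum (X Y : Type) (p : X -> 'M[scalar_type R k]_n)
    (q : Y -> 'M[scalar_type R k]_n) (z : X + Y) : 'M[scalar_type R k]_n :=
  match z with inl x => p x | inr y => q y end.

End MatrixFunctions.

Definition is_metric (R : realType) (Z : Type) (rho : Z -> Z -> R) : Prop :=
  [/\ forall x y, 0 <= rho x y,
      forall x y, rho x y = 0 <-> x = y,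
      forall x y, rho x y = rho y x &
      forall x y z, rho x z <= rho x y + rho y z].

Definition neighborhood (R : realType) (Z : Type) (rho : Z -> Z -> R)
    (A : set Z) (r : R) : set Z :=
  [set z | exists2 a, A a & rho a z < r].

Definition hausdorff_dist (R : realType) (Z : Type) (rho : Z -> Z -> R)
    (A B : set Z) : \bar R :=
  ereal_inf [set r%:E | r in
    [set r : R | [/\ 0 < r, A `<=` neighborhood rho B r &
                     B `<=` neighborhood rho A r]]].

(* Main.v *)
Require Import Defs.
From HB Require Import structures.
From mathcomp Require Import all_boot all_order all_algebra.
From mathcomp Require Import all_classical all_reals all_analysis.
From mathcomp Require Import complex ring lra.

Set Implicit Arguments.
Unset Strict Implicit.
Unset Printing Implicit Defensive.

Import Order.TTheory GRing.Theory Num.Theory.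
Import numFieldNormedType.Exports.

Local Open Scope classical_set_scope.
Local Open Scope ring_scope.

(** Write [Z] for the disjoint union and work at one point of [Z] at a time.
    Let [p0] and [p1] be projection matrices with [|p0 - p1| <= d < 1], and let
    [a = (1 - t) p0 + t p1].  The path is [t |-> p], where [p] is the spectral
    projection of [a] for the part of its spectrum above 1/2.  In terms of the
    symmetries [S_i = 2 p_i - 1], put [A = 2 a - 1 = (1 - t) S_0 + t S_1]; then
    [A^2 = 1 - t (1 - t) (S_0 - S_1)^2], which is within [d^2] of 1.  Its square
    root is [1 - Y], where [Y] is the fixed point of the contraction
    [Y |-> (E + Y^2) / 2] with [E = 1 - A^2], so that [|Y| <= d^2 <= d]; the
    symmetry [S = A (1 - Y)^-1] is the sign of [A], and [p = (1 + S) / 2]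
    ([exists_sqrt_one_sub], [exists_spectral_projection]).

    The constant [(1 - d)^-1] comes from comparing two such pairs [A, S] and
    [B, T].  With [S A = 1 - Y] and [T B = 1 - Y'] one has
    [(1 - Y) (S - T) + (S - T) (1 - Y') = (A - B) - S (A - B) T],
    and since [S] and [T] have norm at most 1, taking norms gives
    [(1 - d) |S - T| <= |A - B|] ([spectral_projection_lipschitz]).  This single
    inequality shows that [p] is determined by [a] (so that the path has the
    right endpoints, and is constant wherever [p0 = p1]), that the path is
    Lipschitz in [t], uniformly over [Z], and that at each time its Lipschitz
    constant in the space variable is at most [(1 - d)^-1] times that of [a],
    which is at most the larger of those of its two ends.

    It remains to bound [|P0 - P1|] on all of [Z] for [P0 = dsum p0 q0] and
    [P1 = dsum p1 q1].  Passing from a point of [Y] to one of [X] at distance at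
    most [eps] changes it by at most [eps (L(P0) + L(P1))] ([opnormB_le_near]),
    which yields part (b); part (a) is the case in which [P0] and [P1] agree on
    one of the two pieces, where the path then stays constant. *)

(** * Real and complex scalars *)

Section Scalars.
Variables (R : realType) (k : scalar_kind).
Local Notation K := (scalar_type R k).
Implicit Types x y : K.

Lemma scalar_conj_is_zmod_morphism : zmod_morphism (@scalar_conj R k).
Proof. by case: k => x y //=; rewrite (raddfB (@conjc R)). Qed.

Lemma scalar_conj_is_monoid_morphism : monoid_morphism (@scalar_conj R k).
Proof.
by case: k; split => //=; [exact: (rmorph1 (@conjc R)) | exact: (rmorphM (@conjc R))].
Qed.

HB.instance Definition _ := GRing.isZmodMorphism.Build K K (@scalar_conj R k)
  scalar_conj_is_zmod_morphism.
HB.instance Definition _ := GRing.isMonoidMorphism.Build K K (@scalar_conj R k)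
  scalar_conj_is_monoid_morphism.

Definition real_scalar : {rmorphism R -> K} :=
  match k with ComplexScalars => real_complex R | RealScalars => idfun end.

Lemma scalar_conj_real (r : R) : scalar_conj (real_scalar r) = real_scalar r.
Proof. by rewrite /real_scalar; case: k => //=; rewrite oppr0. Qed.

Lemma real_scalar_inj : injective real_scalar.
Proof. exact: fmorph_inj. Qed.

Lemma scalar_abs_ge0 x : 0 <= scalar_abs x.
Proof. by case: k x => //= -[a b]; rewrite sqrtr_ge0. Qed.

Lemma scalar_absM x y : scalar_abs (x * y) = scalar_abs x * scalar_abs y.
Proof.
case: k x y => /= x y; last exact: normrM.
exact: ComplexField.Normc.normcM.
Qed.

Lemma scalar_abs0 : scalar_abs (0 : K) = 0.
Proof.
by case: k; [exact: ComplexField.Normc.normc0 | exact: normr0].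
Qed.

Lemma ler_scalar_absD x y : scalar_abs (x + y) <= scalar_abs x + scalar_abs y.
Proof.
by case: k x y => /= x y; [exact: le_normcD | exact: ler_normD].
Qed.

Lemma scalar_abs_real (r : R) : scalar_abs (real_scalar r) = `|r|.
Proof.
by rewrite /real_scalar; case: k => //=; rewrite expr0n addr0 sqrtr_sqr.
Qed.

Lemma real_scalar_sqr_abs x : real_scalar (scalar_abs x ^+ 2) = scalar_conj x * x.
Proof.
rewrite /real_scalar; case: k x => /= x; last by rewrite -normrX ger0_norm ?sqr_ge0 ?expr2.
by rewrite mulrC -sqr_normc rmorphXn.
Qed.

Lemma scalar_conjK : involutive (@scalar_conj R k).
Proof. by case: k => //= -[a b] /=; rewrite opprK. Qed.

Lemma scalar_abs_conj x : scalar_abs (scalar_conj x) = scalar_abs x.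
Proof.
apply/eqP; rewrite -(eqrXn2 (n := 2)) ?scalar_abs_ge0//; apply/eqP.
by apply: real_scalar_inj; rewrite !real_scalar_sqr_abs scalar_conjK mulrC.
Qed.

Lemma scalar_abs_eq0 x : scalar_abs x = 0 -> x = 0.
Proof.
by case: k x => /= x; [exact: ComplexField.Normc.eq0_normc | exact: normr0_eq0].
Qed.

End Scalars.

Lemma geometric_increments_cvg (R : realType) (u : nat -> R) (C e : R) :
    0 <= e < 1 -> (forall m, `|u m.+1 - u m| <= C * e ^+ m) ->
  exists l : R, u @ \oo --> l.
Proof.
move=> /andP[e0 e1] du.
have : cvgn (series (telescope u)).
  apply: normed_cvg; apply: (series_le_cvg (v_ := geometric C e)).
  - by move=> m; exact: normr_ge0.
  - by move=> m /=; apply: le_trans (du m); exact: normr_ge0.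
  - by move=> m; rewrite /geometric/=; exact: du.
  - by apply: is_cvg_geometric_series; rewrite ger0_norm.
move=> cvgs; exists (u 0%N + limn (series (telescope u))).
rewrite [X in X @ _](_ : u = fun m => u 0%N + series (telescope u) m); last first.
  by apply/funext => m; exact: eq_sum_telescope.
by apply: cvgD; [exact: cvg_cst | exact: cvgs].
Qed.

(** Completeness of the scalar field: complex sequences converge because their real and imaginary parts do. *)
Lemma scalar_geometric_cvg (R : realType) (k : scalar_kind)
    (u : nat -> scalar_type R k) (C e : R) :
    0 <= e < 1 -> (forall m, scalar_abs (u m.+1 - u m) <= C * e ^+ m) ->
  exists l, scalar_abs (u m - l) @[m --> \oo] --> (0 : R).
Proof.
case: k u => /= u e01 du; last first.
  have [l ul] := geometric_increments_cvg e01 du.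
  exists l; have := cvg_norm (cvgB ul (cvg_cst l)).
  rewrite subrr normr0; exact.
have dRe m : `|complex.Re (u m.+1) - complex.Re (u m)| <= C * e ^+ m.
  apply: le_trans (du m); case: (u _) (u _) => [a b] [a' b'] /=.
  by rewrite -sqrtr_sqr ler_wsqrtr // lerDl sqr_ge0.
have dIm m : `|complex.Im (u m.+1) - complex.Im (u m)| <= C * e ^+ m.
  apply: le_trans (du m); case: (u _) (u _) => [a b] [a' b'] /=.
  by rewrite -sqrtr_sqr ler_wsqrtr // lerDr sqr_ge0.
have [a ua] := geometric_increments_cvg e01 dRe.
have [b ub] := geometric_increments_cvg e01 dIm.
exists (a +i* b)%C.
apply: (@squeeze_cvgr _ _ _ _ (fun=> 0)
  (fun m => `|complex.Re (u m) - a| + `|complex.Im (u m) - b|)).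
- apply: nearW => m; rewrite (@scalar_abs_ge0 R ComplexScalars)/=.
  case: (u m) => x y /=; rewrite -ler_sqr ?nnegrE ?addr_ge0 ?sqrtr_ge0//.
  rewrite sqr_sqrtr ?addr_ge0 ?sqr_ge0//.
  rewrite -(real_normK (num_real (x - a))) -(real_normK (num_real (y - b))).
  rewrite sqrrD lerD2r lerDl mulrn_wge0// mulr_ge0//.
- exact: cvg_cst.
- have := cvgD (cvg_norm (cvgB ua (cvg_cst a))) (cvg_norm (cvgB ub (cvg_cst b))).
  by rewrite !subrr normr0 addr0; exact.
Qed.

(** * The Hilbert norm and the operator norm *)
(** Lagrange's identity: the difference of the two sides is half the sum of the
    squares of the minors [a i * b j - a j * b i]. *)
Lemma sum_cauchy_schwarz (R : realDomainType) (I : finType) (a b : I -> R) :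
  (\sum_i a i * b i) ^+ 2 <= (\sum_i a i ^+ 2) * (\sum_i b i ^+ 2).
Proof.
have : 0 <= \sum_i \sum_j (a i * b j - a j * b i) ^+ 2.
  by apply: sumr_ge0 => i _; apply: sumr_ge0 => j _; exact: sqr_ge0.
have -> : \sum_i \sum_j (a i * b j - a j * b i) ^+ 2 =
    ((\sum_i a i ^+ 2) * (\sum_i b i ^+ 2) - (\sum_i a i * b i) ^+ 2) *+ 2.
  have bil (f g : I -> R) :
      (\sum_i f i) * (\sum_i g i) = \sum_i \sum_j f i * g j.
    by rewrite mulr_suml; apply: eq_bigr => i _; rewrite mulr_sumr.
  rewrite mulrnBl expr2 mulr2n [X in _ + X - _]mulrC !bil -big_split/=.
  rewrite -sumrMnl -sumrB; apply: eq_bigr => i _.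
  rewrite -big_split/= -sumrMnl -sumrB; apply: eq_bigr => j _; ring.
by rewrite pmulrn_lge0 // subr_ge0.
Qed.

Section HilbertNorm.
Variables (R : realType) (k : scalar_kind).
Local Notation K := (scalar_type R k).

Variable n : nat.
Implicit Types (u v : 'cV[K]_n) (A B : 'M[K]_n).

Lemma hilbert_norm_ge0 v : 0 <= hilbert_norm v.
Proof. exact: sqrtr_ge0. Qed.

Lemma sqr_hilbert_norm v :
  hilbert_norm v ^+ 2 = \sum_(i < n) scalar_abs (v i ord0) ^+ 2.
Proof. by rewrite sqr_sqrtr// sumr_ge0// => i _; exact: sqr_ge0. Qed.

Lemma ler_hilbert_normD u v :
  hilbert_norm (u + v) <= hilbert_norm u + hilbert_norm v.
Proof.
rewrite -ler_sqr ?nnegrE ?addr_ge0 ?hilbert_norm_ge0//.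
rewrite sqrrD !sqr_hilbert_norm.
pose a i := scalar_abs (u i ord0); pose b i := scalar_abs (v i ord0).
apply: (@le_trans _ _ (\sum_i (a i + b i) ^+ 2)).
  apply: ler_sum => i _; rewrite mxE ler_sqr ?nnegrE ?addr_ge0 ?scalar_abs_ge0//.
  exact: ler_scalar_absD.
under eq_bigr do rewrite sqrrD.
rewrite !big_split/= lerD2r lerD2l -mulr2n lerMn2r /=.
rewrite -ler_sqr ?nnegrE ?mulr_ge0 ?hilbert_norm_ge0//; last first.
  by rewrite sumr_ge0// => i _; rewrite mulr_ge0 ?scalar_abs_ge0.
by rewrite exprMn !sqr_hilbert_norm; exact: sum_cauchy_schwarz.
Qed.

Lemma hilbert_normZ (c : K) v : hilbert_norm (c *: v) = scalar_abs c * hilbert_norm v.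
Proof.
apply/eqP; rewrite -(eqrXn2 (n := 2)) ?mulr_ge0 ?hilbert_norm_ge0 ?scalar_abs_ge0//.
rewrite exprMn !sqr_hilbert_norm mulr_sumr; apply/eqP/eq_bigr => i _.
by rewrite mxE scalar_absM exprMn.
Qed.

Lemma hilbert_norm0 : hilbert_norm (0 : 'cV[K]_n) = 0.
Proof.
by rewrite -(scale0r (0 : 'cV[K]_n)) hilbert_normZ scalar_abs0 mul0r.
Qed.

Lemma scalar_abs_le_hilbert_norm v i : scalar_abs (v i ord0) <= hilbert_norm v.
Proof.
rewrite -ler_sqr ?nnegrE ?hilbert_norm_ge0 ?scalar_abs_ge0// sqr_hilbert_norm.
by rewrite (bigD1 i)//= lerDl sumr_ge0// => j _; exact: sqr_ge0.
Qed.

Lemma hilbert_norm_le_sum v : hilbert_norm v <= \sum_i scalar_abs (v i ord0).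
Proof.
rewrite -ler_sqr ?nnegrE ?hilbert_norm_ge0 ?sumr_ge0//; last first.
  by move=> i _; exact: scalar_abs_ge0.
rewrite sqr_hilbert_norm expr2 mulr_suml; apply: ler_sum => i _.
rewrite expr2 ler_wpM2l ?scalar_abs_ge0// (bigD1 i)//= lerDl.
by rewrite sumr_ge0// => j _; exact: scalar_abs_ge0.
Qed.

Lemma hilbert_norm_eq0 v : hilbert_norm v = 0 -> v = 0.
Proof.
move=> v0; apply/matrixP => i j; rewrite ord1 mxE; apply: scalar_abs_eq0.
by apply/eqP; rewrite eq_le scalar_abs_ge0 andbT -v0 scalar_abs_le_hilbert_norm.
Qed.

(** A crude bound, which makes the supremum defining the operator norm that of a
    bounded set. *)
Lemma hilbert_norm_mulmx_le_sum A v :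
  hilbert_norm (A *m v) <= (\sum_i \sum_j scalar_abs (A i j)) * hilbert_norm v.
Proof.
apply: (le_trans (hilbert_norm_le_sum _)); rewrite mulr_suml.
apply: ler_sum => i _; rewrite mxE mulr_suml.
elim/big_ind2 : _ => [|x x' y y' ? ?|j _].
- by rewrite scalar_abs0.
- by apply: (le_trans (ler_scalar_absD _ _)); exact: lerD.
by rewrite scalar_absM ler_wpM2l ?scalar_abs_ge0 ?scalar_abs_le_hilbert_norm.
Qed.

Lemma hilbert_norm_mulmx_le A v :
  hilbert_norm (A *m v) <= opnorm A * hilbert_norm v.
Proof.
have [v0|v_neq0] := eqVneq (hilbert_norm v) 0.
  by rewrite v0 (hilbert_norm_eq0 v0) mulmx0 hilbert_norm0 mulr0.
have v_gt0 : 0 < hilbert_norm v by rewrite lt_def v_neq0 hilbert_norm_ge0.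
rewrite -ler_pdivrMr//.
have vV : scalar_abs (real_scalar R k (hilbert_norm v)^-1) = (hilbert_norm v)^-1.
  by rewrite scalar_abs_real ger0_norm// invr_ge0 hilbert_norm_ge0.
apply: ub_le_sup.
  exists (\sum_i \sum_j scalar_abs (A i j)) => _ [w /= w1 <-].
  apply: (le_trans (hilbert_norm_mulmx_le_sum _ _)).
  rewrite ler_piMr// sumr_ge0// => i _; rewrite sumr_ge0// => j _.
  exact: scalar_abs_ge0.
exists (real_scalar R k (hilbert_norm v)^-1 *: v) => /=.
  by rewrite hilbert_normZ vV mulVf.
by rewrite -scalemxAr hilbert_normZ vV mulrC.
Qed.

Lemma opnorm_le A c : 0 <= c ->
  (forall v, hilbert_norm (A *m v) <= c * hilbert_norm v) -> opnorm A <= c.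
Proof.
move=> c0 Ac; apply: ge_sup.
  by exists 0 => /=; exists 0 => /=; rewrite ?mulmx0 hilbert_norm0.
move=> _ [v /= v1 <-]; apply: (le_trans (Ac v)).
by rewrite ler_piMr.
Qed.

Lemma opnorm_ge0 A : 0 <= opnorm A.
Proof.
apply: ub_le_sup; last by exists 0 => /=; rewrite ?mulmx0 hilbert_norm0.
exists (\sum_i \sum_j scalar_abs (A i j)) => _ [w /= w1 <-].
apply: (le_trans (hilbert_norm_mulmx_le_sum _ _)).
rewrite ler_piMr// sumr_ge0// => i _; rewrite sumr_ge0// => j _.
exact: scalar_abs_ge0.
Qed.

Lemma opnorm_le_sum A : opnorm A <= \sum_i \sum_j scalar_abs (A i j).
Proof.
apply: opnorm_le; last exact: hilbert_norm_mulmx_le_sum.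
by rewrite sumr_ge0// => i _; rewrite sumr_ge0// => j _; exact: scalar_abs_ge0.
Qed.

(** Together with [opnorm_le_sum], this makes operator-norm convergence the same
    as entrywise convergence. *)
Lemma scalar_abs_le_opnorm A i j : scalar_abs (A i j) <= opnorm A.
Proof.
have e1 : hilbert_norm (delta_mx j ord0 : 'cV[K]_n) = 1.
  rewrite /hilbert_norm (bigD1 j)//= big1 => [|l lj].
    rewrite mxE !eqxx -(rmorph1 (real_scalar R k)) scalar_abs_real.
    by rewrite normr1 expr1n addr0 sqrtr1.
  by rewrite mxE (negPf lj) scalar_abs0 expr0n.
have := hilbert_norm_mulmx_le A (delta_mx j ord0); rewrite e1 mulr1 -colE.
by apply: le_trans; have := scalar_abs_le_hilbert_norm (col j A) i; rewrite mxE.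
Qed.

Lemma ler_opnormD A B : opnorm (A + B) <= opnorm A + opnorm B.
Proof.
apply: opnorm_le => [|v]; first by rewrite addr_ge0 ?opnorm_ge0.
rewrite mulmxDl mulrDl; apply: (le_trans (ler_hilbert_normD _ _)).
by rewrite lerD ?hilbert_norm_mulmx_le.
Qed.

Lemma ler_opnormM A B : opnorm (A * B) <= opnorm A * opnorm B.
Proof.
apply: opnorm_le => [|v]; first by rewrite mulr_ge0 ?opnorm_ge0.
rewrite -mulmxA; apply: (le_trans (hilbert_norm_mulmx_le _ _)).
by rewrite -mulrA ler_wpM2l ?opnorm_ge0 ?hilbert_norm_mulmx_le.
Qed.

Lemma ler_opnormM_trans (c d : R) A B :
  opnorm A <= c -> opnorm B <= d -> opnorm (A * B) <= c * d.
Proof.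
move=> Ac Bd; apply: (le_trans (ler_opnormM A B)).
by apply: ler_pM => //; exact: opnorm_ge0.
Qed.

Lemma mulmx_scaler_r (c : K) A B : A * (c *: B) = c *: (A * B).
Proof. exact: esym (scalemxAr c A B). Qed.

Lemma mulmx_scaler_l (c : K) A B : (c *: A) * B = c *: (A * B).
Proof. exact: esym (scalemxAl c A B). Qed.

Lemma ler_opnormZ (c : K) A : opnorm (c *: A) <= scalar_abs c * opnorm A.
Proof.
apply: opnorm_le => [|v]; first by rewrite mulr_ge0 ?opnorm_ge0 ?scalar_abs_ge0.
rewrite -scalemxAl hilbert_normZ -mulrA ler_wpM2l ?scalar_abs_ge0//.
exact: hilbert_norm_mulmx_le.
Qed.

Lemma opnormZ (c : K) A : opnorm (c *: A) = scalar_abs c * opnorm A.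
Proof.
have [->|c0] := eqVneq c 0.
  rewrite scale0r scalar_abs0 mul0r; apply/eqP; rewrite eq_le opnorm_ge0 andbT.
  by rewrite -(mul0r (opnorm A)) -(scalar_abs0 R k) -(scale0r A) ler_opnormZ.
apply/eqP; rewrite eq_le ler_opnormZ/=.
rewrite -{1}(scalerK c0 A).
have abs_c : 0 < scalar_abs c.
  rewrite lt_def scalar_abs_ge0 andbT; apply: contra_neq c0.
  exact: scalar_abs_eq0.
have cV : scalar_abs c^-1 = (scalar_abs c)^-1.
  apply: (mulfI (lt0r_neq0 abs_c)); rewrite -scalar_absM divff// divff ?lt0r_neq0//.
  by rewrite -(rmorph1 (real_scalar R k)) scalar_abs_real normr1.
by rewrite -ler_pdivlMl// -cV ler_opnormZ.
Qed.

Lemma opnorm0 : opnorm (0 : 'M[K]_n) = 0.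
Proof. by rewrite -(scale0r (0 : 'M[K]_n)) opnormZ scalar_abs0 mul0r. Qed.

Lemma opnormN A : opnorm (- A) = opnorm A.
Proof.
by rewrite -scaleN1r opnormZ -(rmorphN1 (real_scalar R k)) scalar_abs_real normrN1 mul1r.
Qed.

Lemma opnormB A B : opnorm (A - B) = opnorm (B - A).
Proof. by rewrite -opnormN opprB. Qed.

Lemma ler_opnormB A B : opnorm (A - B) <= opnorm A + opnorm B.
Proof. by rewrite -(opnormN B) ler_opnormD. Qed.

Lemma opnorm_mulr2n A : opnorm (A *+ 2) = 2 * opnorm A.
Proof.
by rewrite -scaler_nat opnormZ -(rmorph_nat (real_scalar R k)) scalar_abs_real normr_nat.
Qed.

Lemma opnorm_eq0 A : opnorm A = 0 -> A = 0.
Proof.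
move=> A0; apply/matrixP => i j; rewrite mxE; apply: scalar_abs_eq0.
by apply/eqP; rewrite eq_le scalar_abs_ge0 andbT -A0 scalar_abs_le_opnorm.
Qed.

Lemma adjointM A B : adjoint (A * B) = adjoint B * adjoint A.
Proof. by rewrite /adjoint trmx_mul map_mxM. Qed.

Lemma adjointB A B : adjoint (A - B) = adjoint A - adjoint B.
Proof. by rewrite /adjoint linearB/= map_mxB. Qed.

Lemma adjointD A B : adjoint (A + B) = adjoint A + adjoint B.
Proof. by rewrite /adjoint linearD/= map_mxD. Qed.

Lemma adjoint_real_scale (r : R) A :
  adjoint (real_scalar R k r *: A) = real_scalar R k r *: adjoint A.
Proof. by rewrite /adjoint linearZ/= map_mxZ; congr (_ *: _); exact: scalar_conj_real. Qed.

Lemma adjoint0 : adjoint (0 : 'M[K]_n) = 0.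
Proof. by rewrite /adjoint trmx0 map_mx0. Qed.

Lemma adjoint1 : adjoint (1 : 'M[K]_n) = 1.
Proof. by rewrite /adjoint trmx1 map_mx1. Qed.

(** An isometry preserves [v^* v], which is the squared Hilbert norm. *)
Lemma opnorm_isometry_le1 A : adjoint A * A = 1 -> opnorm A <= 1.
Proof.
move=> AA1; apply: opnorm_le => // v; rewrite mul1r.
have gram (w : 'cV[K]_n) : real_scalar R k (hilbert_norm w ^+ 2) =
    (map_mx (@scalar_conj R k) w^T *m w) ord0 ord0.
  rewrite sqr_hilbert_norm rmorph_sum/= mxE; apply: eq_bigr => i _.
  by rewrite real_scalar_sqr_abs !mxE.
rewrite -ler_sqr ?nnegrE ?hilbert_norm_ge0//.
suff -> : hilbert_norm (A *m v) ^+ 2 = hilbert_norm v ^+ 2 by [].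
apply: (@real_scalar_inj R k); rewrite !gram trmx_mul map_mxM -mulmxA.
by rewrite [X in _ *m X]mulmxA [_ *m A](AA1) mul1mx.
Qed.

End HilbertNorm.

(** * Square roots near the identity *)
Section SquareRoot.
Variables (R : realType) (k : scalar_kind) (n : nat).
Local Notation K := (scalar_type R k).
Implicit Types (A B E Y : 'M[K]_n) (y : nat -> 'M[K]_n).

Lemma opnorm_geometric_cvg y (C e : R) : 0 <= e < 1 ->
    (forall m, opnorm (y m.+1 - y m) <= C * e ^+ m) ->
  exists Y, opnorm (y m - Y) @[m --> \oo] --> (0 : R).
Proof.
move=> e01 dy.
have entry_cvg (ij : 'I_n * 'I_n) : exists l : K,
    scalar_abs (y m ij.1 ij.2 - l) @[m --> \oo] --> (0 : R).
  apply: (scalar_geometric_cvg e01) => m; apply: le_trans (dy m).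
  by have := scalar_abs_le_opnorm (y m.+1 - y m) ij.1 ij.2; rewrite !mxE.
have [l y_l] := choice entry_cvg.
exists (\matrix_(i, j) l (i, j)).
apply: (@squeeze_cvgr _ _ _ _ (fun=> 0)
  (fun m => \sum_i \sum_j scalar_abs (y m i j - l (i, j)))).
- apply: nearW => m; rewrite opnorm_ge0/=; apply: (le_trans (opnorm_le_sum _)).
  by apply: ler_sum => i _; apply: ler_sum => j _; rewrite !mxE.
- exact: cvg_cst.
rewrite [X in _ --> X](_ : 0 = \sum_(i < n) \sum_(j < n) (0 : R)); last first.
  by rewrite big1// => i _; rewrite big1.
apply: cvg_big => [|i _]; first exact: add_continuous.
apply: cvg_big => [|j _]; first exact: add_continuous.
exact: (y_l (i, j)).
Qed.

Lemma ler_vanishing_error (f : nat -> R) (a b : R) :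
  f @ \oo --> (0 : R) -> (forall m, a <= b + f m) -> a <= b.
Proof.
move=> f0 ab; have bf : (fun m => b + f m) @ \oo --> b.
  by rewrite -[X in _ --> X]addr0; apply: cvgD => //; exact: cvg_cst.
by apply: (cvgr_to_ge bf); exact: nearW.
Qed.

Lemma vanishingMl (c : R) (f : nat -> R) :
  f @ \oo --> (0 : R) -> c * f m @[m --> \oo] --> (0 : R).
Proof.
by move=> f0; have := cvgM (cvg_cst c) f0; rewrite mulr0; exact.
Qed.

(** The second conclusion says [(1 - Y)^2 = 1 - E].  The map [Y |-> (E + Y^2) / 2]
    sends the ball of radius [|E|] to itself and contracts it by the factor [|E|],
    so its iterates from 0 converge; each iterate is self-adjoint and commutes
    with all that commutes with [E], and both properties pass to the limit. *)
Lemma exists_sqrt_one_sub E : opnorm E < 1 ->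
  exists Y, [/\ opnorm Y <= opnorm E, Y *+ 2 = E + Y * Y,
    adjoint E = E -> adjoint Y = Y &
    forall B, B * E = E * B -> B * Y = Y * B].
Proof.
set e := opnorm E => e_lt1; have e_ge0 : 0 <= e by exact: opnorm_ge0.
pose half : K := real_scalar R k 2^-1.
have abs_half : scalar_abs half = 2^-1 by rewrite scalar_abs_real ger0_norm.
pose y := fix y m := if m is m'.+1 then half *: (E + y m' * y m') else 0.
have yS m : y m.+1 = half *: (E + y m * y m) by [].
have y_le m : opnorm (y m) <= e.
  elim: m => [|m IH]; first by rewrite opnorm0.
  rewrite yS opnormZ abs_half.
  have h1 := ler_opnormD E (y m * y m); have h2 := ler_opnormM (y m) (y m).
  have h3 := opnorm_ge0 (y m); rewrite -/e in h1; nra.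
have sqB A B : A * A - B * B = A * (A - B) + (A - B) * B.
  by rewrite mulrBr mulrBl addrA subrK.
have sqB_le A B : opnorm A <= e -> opnorm B <= e ->
    opnorm (A * A - B * B) <= e *+ 2 * opnorm (A - B).
  move=> Ae Be; rewrite sqB; apply: (le_trans (ler_opnormD _ _)).
  have := ler_opnormM A (A - B); have := ler_opnormM (A - B) B.
  have := opnorm_ge0 (A - B); nra.
have dy m : opnorm (y m.+1 - y m) <= e * e ^+ m.
  elim: m => [|m IH].
    by rewrite subr0 expr0 mulr1.
  rewrite [y m.+2]yS [in X in _ - X]yS -scalerBr opnormZ abs_half.
  rewrite opprD addrACA subrr add0r exprS.
  have := sqB_le _ _ (y_le m.+1) (y_le m); nra.
have [|Y yY] := opnorm_geometric_cvg _ dy; first by rewrite e_ge0.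
have Y_le : opnorm Y <= e.
  apply: (ler_vanishing_error yY) => m.
  rewrite -[in X in X <= _](subrK (y m) Y) addrC.
  by apply: (le_trans (ler_opnormD _ _)); rewrite lerD ?y_le// opnormB.
have opnorm_limit_eq0 (c : R) A : (forall m, opnorm A <= c * opnorm (y m - Y)) ->
    A = 0.
  move=> Ac; apply: opnorm_eq0; apply/eqP; rewrite eq_le opnorm_ge0 andbT.
  apply: (@ler_vanishing_error (fun m => c * opnorm (y m - Y))) => [|m].
    exact: vanishingMl.
  by rewrite add0r.
exists Y; split => //.
- apply/eqP; rewrite -subr_eq0; apply/eqP; apply: opnorm_eq0; apply/eqP.
  rewrite eq_le opnorm_ge0 andbT.
  have yYS : opnorm (y m.+1 - Y) @[m --> \oo] --> (0 : R).
    by rewrite (cvg_shiftS (fun m => opnorm (y m - Y))).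
  have err0 : 2 * opnorm (y m.+1 - Y) + e *+ 2 * opnorm (y m - Y) @[m --> \oo] -->
      (0 : R).
    rewrite -[X in _ --> X]addr0.
    by apply: cvgD; exact: vanishingMl.
  apply: (ler_vanishing_error err0) => m.
  have -> : Y *+ 2 - (E + Y * Y) =
      (Y - y m.+1) *+ 2 + (y m * y m - Y * Y).
    have yE : y m.+1 *+ 2 = E + y m * y m.
      rewrite yS -scaler_nat scalerA -(rmorph_nat (real_scalar R k)) -rmorphM.
      by rewrite divff// rmorph1 scale1r.
    by rewrite mulrnBl yE -[RHS]addrA; congr (_ + _); rewrite !opprD addrA subrK.
  rewrite add0r; apply: (le_trans (ler_opnormD _ _)).
  rewrite opnorm_mulr2n (opnormB Y).
  by apply: lerD => //; exact: sqB_le (y_le m) Y_le.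
- move=> EE.
  have y_adj m : adjoint (y m) = y m.
    elim: m => [|m IH]; first exact: adjoint0.
    by rewrite yS adjoint_real_scale adjointD adjointM EE IH.
  apply/eqP; rewrite -subr_eq0; apply/eqP/matrixP => i j.
  rewrite [RHS]mxE; apply: scalar_abs_eq0; apply/eqP.
  rewrite eq_le scalar_abs_ge0 andbT.
  apply: (@ler_vanishing_error (fun m => 2 * opnorm (y m - Y))) => [|m].
    exact: vanishingMl.
  have -> : adjoint Y - Y = adjoint (Y - y m) + (y m - Y).
    by rewrite adjointB y_adj addrA subrK.
  rewrite add0r mxE mulr_natl mulr2n; apply: (le_trans (ler_scalar_absD _ _)).
  rewrite lerD ?scalar_abs_le_opnorm// opnormB 2!mxE scalar_abs_conj.
  exact: scalar_abs_le_opnorm.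
- move=> B BE.
  have By m : B * y m = y m * B.
    elim: m => [|m IH]; first by rewrite mulr0 mul0r.
    rewrite yS mulmx_scaler_r mulmx_scaler_l mulrDr mulrDl BE; congr (_ *: (_ + _)).
    by rewrite mulrA IH -mulrA IH mulrA.
  apply/eqP; rewrite -subr_eq0; apply/eqP.
  apply: (@opnorm_limit_eq0 (opnorm B *+ 2)) => m.
  have -> : B * Y - Y * B = (y m - Y) * B - B * (y m - Y).
    by rewrite mulrBl mulrBr By opprB [RHS]addrC addrA subrK.
  apply: (le_trans (ler_opnormB _ _)).
  have := ler_opnormM (y m - Y) B; have := ler_opnormM B (y m - Y).
  nra.
Qed.

End SquareRoot.

(** * Spectral projections *)

(** Proves identities that are linear in opaque matrices, by comparing entries in
    the commutative field of scalars. *)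
Ltac entrywise :=
  rewrite ?mulr2n; apply/matrixP => i j; rewrite !mxE; ring.

Section SpectralProjection.
Variables (R : realType) (k : scalar_kind) (n : nat).
Local Notation K := (scalar_type R k).
Implicit Types (a b p q A B E S T Y : 'M[K]_n) (d t : R).

Definition projector p := p * p = p /\ adjoint p = p.

(** A vector killed by [1 - Y] is fixed by [Y], hence zero. *)
Lemma opnorm_small_unitmx Y : opnorm Y < 1 -> 1 - Y \in unitmx.
Proof.
move=> Y1; rewrite unitmxE unitfE -det_tr; apply/det0P => -[v v0 vY].
have vE : v^T = Y *m v^T.
  apply/eqP; rewrite -subr_eq0 -{1}(mul1mx v^T) -mulmxBl.
  by rewrite -[1%:M - Y]trmxK -trmx_mul vY trmx0.
have v_gt0 : 0 < hilbert_norm v^T.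
  rewrite lt_def hilbert_norm_ge0 andbT; apply: contra_neq v0.
  by move=> /hilbert_norm_eq0 v0; rewrite -[v]trmxK v0 trmx0.
have := hilbert_norm_mulmx_le Y v^T; rewrite -vE.
by rewrite leNgt gtr_pMl// Y1.
Qed.

Lemma inverse_one_sub Y : opnorm Y < 1 -> exists V,
  [/\ V * (1 - Y) = 1, (1 - Y) * V = 1, adjoint Y = Y -> adjoint V = V &
      forall B, B * Y = Y * B -> B * V = V * B].
Proof.
move=> /opnorm_small_unitmx uY; exists (invmx (1 - Y)); set V := invmx _.
have VK : V * (1 - Y) = 1 by exact: mulVmx.
have KV : (1 - Y) * V = 1 by exact: mulmxV.
split=> // [Y_adj|B BY].
  rewrite -[LHS]mulr1 -KV mulrA -[X in _ * X * _](_ : adjoint (1 - Y) = _).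
    by rewrite -adjointM KV adjoint1 mul1r.
  by rewrite adjointB adjoint1 Y_adj.
have BK : B * (1 - Y) = (1 - Y) * B by rewrite mulrBr mulrBl mulr1 mul1r BY.
by rewrite -[LHS]mul1r -VK -[in LHS]mulrA [_ * (B * V)]mulrA -BK -!mulrA KV mulr1.
Qed.

(** The reflection in the range of [p] when [p] is a projection; it is also applied
    to convex combinations of projections. *)
Definition reflection p := p *+ 2 - 1.

Lemma reflectionB p q : reflection p - reflection q = (p - q) *+ 2.
Proof. by rewrite /reflection opprB addrA subrK mulrnBl. Qed.

Lemma opnorm_reflectionB p q :
  opnorm (reflection p - reflection q) = 2 * opnorm (p - q).
Proof. by rewrite reflectionB opnorm_mulr2n. Qed.

Lemma reflection_sqr p : p * p = p -> reflection p * reflection p = 1.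
Proof.
move=> pp; rewrite /reflection mulrBr mulr1 mulrBl mul1r mulrnAl mulrnAr pp.
by move: (1 : 'M[K]_n) => e; entrywise.
Qed.

Lemma adjoint_reflection p : adjoint p = p -> adjoint (reflection p) = reflection p.
Proof. by move=> pp; rewrite adjointB adjointD pp adjoint1. Qed.

Lemma opnorm_reflection_le1 p : projector p -> opnorm (reflection p) <= 1.
Proof.
by case=> pp padj; apply: opnorm_isometry_le1; rewrite adjoint_reflection ?reflection_sqr.
Qed.

(** [p] is the spectral projection of [a] for the part of the spectrum above 1/2,
    phrased without a functional calculus.  When [a] is self-adjoint and [d < 1],
    the product in the last condition is the absolute value of [2 a - 1], and the
    condition bounds its distance from 1. *)
Definition spectral_projection d a p :=
  [/\ projector p, p * a = a * p &
      opnorm (1 - reflection p * reflection a) <= d].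

Lemma reflection_comm p a : p * a = a * p ->
  reflection p * reflection a = reflection a * reflection p.
Proof.
move=> pa; rewrite /reflection !(mulrBl, mulrBr) !mul1r !mulr1 !mulrnAl !mulrnAr pa.
by move: (1 : 'M[K]_n) (a * p) => e ap; entrywise.
Qed.

(** The source of the constant [(1 - d)^-1].  The difference of the two
    reflections solves a Sylvester equation whose two coefficients are within [d]
    of 1. *)
Lemma spectral_projection_lipschitz d a b p q :
    spectral_projection d a p -> spectral_projection d b q ->
  (1 - d) * opnorm (p - q) <= opnorm (a - b).
Proof.
move=> [pP pa ad] [qQ qb bd].
have S_le := opnorm_reflection_le1 pP; have T_le := opnorm_reflection_le1 qQ.
have SS := reflection_sqr pP.1; have TT := reflection_sqr qQ.1.
have SA := reflection_comm pa; have TB := reflection_comm qb.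
move: (opnorm_reflectionB p q) (opnorm_reflectionB a b).
move: (reflection p) (reflection q) (reflection a) (reflection b) ad bd S_le T_le SS TT SA TB
  => S T A B ad bd S_le T_le SS TT SA TB STn ABn.
(* The Sylvester equation, with its coefficients expanded around 1. *)
have ABE : (S - T) *+ 2 = ((A - B) - S * (A - B) * T)
    + ((1 - S * A) * (S - T) + (S - T) * (1 - T * B)).
  have -> : (1 - S * A) * (S - T) = S - T - (A - S * A * T).
    by rewrite mulrBl mul1r mulrBr {1}SA -[A * S * S]mulrA SS mulr1.
  have -> : (S - T) * (1 - T * B) = S - T - (S * B * T - B).
    by rewrite mulrBr mulr1 mulrBl [T * (T * B)]mulrA TT mul1r TB mulrA.
  have -> : S * (A - B) * T = S * A * T - S * B * T by rewrite mulrBr mulrBl.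
  by move: (S * A * T) (S * B * T) => SAT SBT; entrywise.
have h1 : opnorm (S * (A - B) * T) <= opnorm (A - B).
  rewrite -[leRHS]mulr1 -[X in X * 1]mul1r.
  by apply: ler_opnormM_trans => //; exact: ler_opnormM_trans.
have h2 : opnorm ((1 - S * A) * (S - T)) <= d * opnorm (S - T).
  exact: ler_opnormM_trans.
have h3 : opnorm ((S - T) * (1 - T * B)) <= opnorm (S - T) * d.
  exact: ler_opnormM_trans.
have h4 := ler_opnormD ((A - B) - S * (A - B) * T)
  ((1 - S * A) * (S - T) + (S - T) * (1 - T * B)).
have h5 := ler_opnormB (A - B) (S * (A - B) * T).
have h6 := ler_opnormD ((1 - S * A) * (S - T)) ((S - T) * (1 - T * B)).
rewrite -ABE opnorm_mulr2n STn in h4.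
rewrite STn in h2; rewrite STn in h3; rewrite ABn in h1; rewrite ABn in h5.
move: h1 h2 h3 h4 h5 h6; clear.
move: (opnorm (S * _ * T)) (opnorm (_ - S * _ * T)) (opnorm (_ * (S - T)))
  (opnorm (_ * (1 - T * B))) (opnorm (_ + (S - T) * _)) (opnorm (p - q)) (opnorm (a - b)).
move=> r1 r2 r3 r4 r5 x y h1 h2 h3 h4 h5 h6; lra.
Qed.

Lemma spectral_projection_unique d a p q : d < 1 ->
  spectral_projection d a p -> spectral_projection d a q -> p = q.
Proof.
move=> d1 ap aq; apply/eqP; rewrite -subr_eq0; apply/eqP/opnorm_eq0/eqP.
rewrite eq_le opnorm_ge0 andbT.
have := spectral_projection_lipschitz ap aq.
by rewrite subrr opnorm0 pmulr_rle0// subr_gt0.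
Qed.

Lemma spectral_projection_id d p : 0 <= d -> projector p ->
  spectral_projection d p p.
Proof.
by move=> d0 pP; split=> //; rewrite reflection_sqr ?subrr ?opnorm0//; exact: pP.1.
Qed.

Definition segment p0 p1 t := real_scalar R k (1 - t) *: p0 + real_scalar R k t *: p1.

Lemma reflection_segment p0 p1 t :
  reflection (segment p0 p1 t) = segment (reflection p0) (reflection p1) t.
Proof.
rewrite /reflection /segment rmorphB rmorph1.
by move: (1 : 'M[K]_n) (real_scalar R k t) => e t'; entrywise.
Qed.

Lemma segmentB p0 p1 s t :
  segment p0 p1 s - segment p0 p1 t = real_scalar R k (s - t) *: (p1 - p0).
Proof.
rewrite /segment !rmorphB rmorph1.
by move: (real_scalar R k s) (real_scalar R k t) => s' t'; entrywise.
Qed.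

(** Symmetries are square roots of 1, so the cross terms [S T + T S] can be traded
    for [(S - T)^2], which is small when [S] and [T] are close. *)
Lemma segment_sqr S T t : S * S = 1 -> T * T = 1 ->
  segment S T t * segment S T t =
  1 - real_scalar R k ((1 - t) * t) *: ((S - T) * (S - T)).
Proof.
move=> SS TT.
rewrite /segment [(S - T) * _]mulrBl [S * (S - T)]mulrBr [T * (S - T)]mulrBr.
rewrite mulrDl !mulrDr !mulmx_scaler_l !mulmx_scaler_r SS TT rmorphM rmorphB rmorph1.
move: (1 : 'M[K]_n) (S * T) (T * S) (real_scalar R k t) => e ST TS t'.
by entrywise.
Qed.

(** The reflection of the required projection is the sign [A (1 - Y)^-1] of
    [A = 2 a - 1], where [1 - Y] is the square root of [A^2] provided by
    [exists_sqrt_one_sub]. *)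
Lemma exists_spectral_projection d p0 p1 t : projector p0 -> projector p1 ->
    opnorm (p0 - p1) <= d -> d < 1 -> 0 <= t <= 1 ->
  exists p, spectral_projection d (segment p0 p1 t) p.
Proof.
move=> P0 P1 pd d1 /andP[t0 t1].
have d0 : 0 <= d by apply: le_trans pd; exact: opnorm_ge0.
set a := segment p0 p1 t.
set S0 := reflection p0; set S1 := reflection p1; set A := reflection a.
have AE : A = segment S0 S1 t by exact: reflection_segment.
have SS0 : S0 * S0 = 1 by exact: reflection_sqr P0.1.
have SS1 : S1 * S1 = 1 by exact: reflection_sqr P1.1.
have adjS0 : adjoint S0 = S0 by exact: adjoint_reflection P0.2.
have adjS1 : adjoint S1 = S1 by exact: adjoint_reflection P1.2.
have adjA : adjoint A = A.
  by rewrite AE adjointD !adjoint_real_scale adjS0 adjS1.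
pose D := S0 - S1.
pose E := real_scalar R k ((1 - t) * t) *: (D * D).
have AA : A * A = 1 - E by rewrite AE segment_sqr.
(* |E| <= t (1 - t) (2 d)^2 <= d^2 <= d, because t (1 - t) <= 1/4. *)
have E_le : opnorm E <= d.
  rewrite /E opnormZ scalar_abs_real ger0_norm ?mulr_ge0 ?subr_ge0//.
  have := ler_opnormM D D; rewrite opnorm_reflectionB.
  have := opnorm_ge0 (p0 - p1); have := opnorm_ge0 (D * D).
  move: (opnorm (D * D)) (opnorm (p0 - p1)) pd => x y pd x0 y0 xy.
  have c4 : (1 - t) * t <= 4^-1 by have := sqr_ge0 (t - 2^-1); nra.
  have c0 : 0 <= (1 - t) * t by rewrite mulr_ge0// subr_ge0.
  have yd : y * y <= d by rewrite -[d]mulr1 ler_pM//; lra.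
  apply: (le_trans (ler_wpM2r x0 c4)); lra.
have adjE : adjoint E = E.
  by rewrite /E adjoint_real_scale adjointM /D adjointB adjS0 adjS1.
have AEc : A * E = E * A.
  have -> : E = 1 - A * A by rewrite AA opprB addrC subrK.
  by rewrite [A * (1 - _)]mulrBr [(1 - _) * A]mulrBl mulr1 mul1r mulrA.
have [Y [Y_le YE adjY comY]] := exists_sqrt_one_sub (le_lt_trans E_le d1).
have AY := comY _ AEc.
have [V [VK KV adjV comV]] := inverse_one_sub (le_lt_trans (le_trans Y_le E_le) d1).
have AV := comV _ AY.
have KK : (1 - Y) * (1 - Y) = 1 - E.
  have -> : E = Y *+ 2 - Y * Y by rewrite YE addrK.
  rewrite mulrBr mulr1 mulrBl mul1r.
  by move: (1 : 'M[K]_n) (Y * Y) => e YY; entrywise.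
pose S := A * V.
have SK : S * (1 - Y) = A by rewrite /S -mulrA VK mulr1.
have AS : A * S = S * A by rewrite /S -mulrA -AV.
have SS : S * S = 1.
  rewrite /S mulrA -[A * V * A]mulrA -AV mulrA AA -KK -!mulrA.
  rewrite [(1 - Y) * (V * V)]mulrA KV mul1r.
  exact: KV.
have SA : S * A = 1 - Y by rewrite -SK mulrA SS mul1r.
have adjS : adjoint S = S by rewrite /S adjointM adjA adjV ?adjY// AV.
clearbody S.
pose half : K := real_scalar R k 2^-1.
have half2 (B : 'M[K]_n) : (half *: B) *+ 2 = B.
  rewrite -scaler_nat scalerA -(rmorph_nat (real_scalar R k)) -rmorphM.
  by rewrite divff// rmorph1 scale1r.
exists (half *: (1 + S)).
have pE : (half *: (1 + S)) *+ 2 - 1 = S by rewrite half2 addrC addKr.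
split.
- split; last by rewrite adjoint_real_scale adjointD adjoint1 adjS.
  rewrite mulmx_scaler_l mulmx_scaler_r mulrDl !mulrDr SS !mulr1 !mul1r.
  have -> : 1 + S + (S + 1) = (1 + S) *+ 2 by rewrite [S + 1]addrC.
  by rewrite -scalerMnr half2.
- have -> : a = half *: (1 + A).
    by rewrite /A /reflection addrC subrK -scalerMnr half2.
  rewrite !mulmx_scaler_l !mulmx_scaler_r; do 2 congr (_ *: _).
  apply: commrD; first exact: commr1.
  by apply/commr_sym/commrD; [exact: commr1 | exact: AS].
- by rewrite /reflection pE -/(reflection a) -/A SA opprB addrC subrK (le_trans Y_le).
Qed.

End SpectralProjection.

(** * Paths of projections over a metric space *)
Section ProjectionPath.
Variables (R : realType) (k : scalar_kind) (n : nat).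
Local Notation K := (scalar_type R k).

Lemma cnorm_ge0 (W : Type) (a : W -> 'M[K]_n) : (0 <= cnorm a)%E.
Proof. by apply: ereal_sup_ubound; left. Qed.

Lemma opnorm_le_cnorm (W : Type) (a : W -> 'M[K]_n) w : ((opnorm (a w))%:E <= cnorm a)%E.
Proof. by apply: ereal_sup_ubound; right; exists w. Qed.

Lemma cnorm_le (W : Type) (a : W -> 'M[K]_n) (c : R) : 0 <= c ->
  (forall w, opnorm (a w) <= c) -> (cnorm a <= c%:E)%E.
Proof.
move=> c0 ac; apply: ge_ereal_sup => _ [->|[w _ <-]]; rewrite lee_fin//.
Qed.

Lemma Lip_ge0 (W : Type) (rho : W -> W -> R) (a : W -> 'M[K]_n) : (0 <= Lip rho a)%E.
Proof. by apply: ereal_sup_ubound; left. Qed.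

Lemma Lip_le (W : Type) (rho : W -> W -> R) (a : W -> 'M[K]_n) (c : R) :
    0 <= c -> (forall w w', 0 <= rho w w') ->
    (forall w w', opnorm (a w - a w') <= c * rho w w') ->
  (Lip rho a <= c%:E)%E.
Proof.
move=> c0 rho0 ac; apply: ge_ereal_sup => _ [->|[[w w'] _ <-]]; rewrite lee_fin//=.
have [->|r0] := eqVneq (rho w w') 0; first by rewrite invr0 mulr0.
by rewrite ler_pdivrMr// lt_def r0 rho0.
Qed.

Lemma opnorm_le_Lip (W : Type) (rho : W -> W -> R) (a : W -> 'M[K]_n) (L : R) w w' :
  is_metric rho -> Lip rho a = L%:E -> opnorm (a w - a w') <= L * rho w w'.
Proof.
move=> [rho0 rho_eq0 _ _] LE.
have [ww'|ww'] := pselect (w = w').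
  by rewrite ww' subrr opnorm0 (rho_eq0 w' w').2// mulr0.
rewrite -ler_pdivrMr; last first.
  by rewrite lt_def rho0 andbT; apply/eqP => /rho_eq0.
by rewrite -lee_fin -LE; apply: ereal_sup_ubound; right; exists (w, w').
Qed.

Lemma lipschitz_opnorm_continuous (W : metricType R) (a : W -> 'M[K]_n) (C : R) :
  (forall w w', opnorm (a w - a w') <= C * mdist w w') -> opnorm_continuous a.
Proof.
move=> aC w; apply/cvgrPdist_le => e e0; near=> v.
rewrite sub0r normrN ger0_norm ?opnorm_ge0// opnormB.
apply: (le_trans (aC w v)).
have C1 : 0 < `|C| + 1 by rewrite ltr_wpDl.
apply: (@le_trans _ _ ((`|C| + 1) * mdist w v)).
  rewrite ler_wpM2r ?mdist_ge0//; apply: (le_trans (ler_norm C)).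
  by rewrite lerDl.
rewrite mulrC -ler_pdivlMr// ltW//.
near: v; apply/nbhs_ballP; exists (e / (`|C| + 1)) => /=; first exact: divr_gt0.
by move=> v; rewrite ballEmdist.
Unshelve. all: by end_near. Qed.

(** Lipschitz bounds in space and in time are all that a path of Lipschitz
    projections requires. *)
Lemma lipschitz_projection_path (W : metricType R) (r : R -> W -> 'M[K]_n) (C : R) :
    (forall t : R, 0 <= t <= 1 -> projection (r t)) ->
    (forall (t : R) w w', 0 <= t <= 1 -> opnorm (r t w - r t w') <= C * mdist w w') ->
    (forall (s t : R) w, 0 <= s <= 1 -> 0 <= t <= 1 ->
      opnorm (r s w - r t w) <= C * `|s - t|) ->
  projection_path r (r 0) (r 1).
Proof.
wlog C0 : C / 0 < C => [th rP rC rT|rP rC rT].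
  have CC : C <= `|C| + 1 by rewrite (le_trans (ler_norm C))// lerDl.
  apply: (th (`|C| + 1)) => // [t w w' t01|s t w s01 t01].
  - by apply: (le_trans (rC t w w' t01)); apply: ler_wpM2r => //; exact: mdist_ge0.
  - by apply: (le_trans (rT s t w s01 t01)); apply: ler_wpM2r.
split => // [t t01|t t01].
  split; [| |exact: rP].
    by apply: (@lipschitz_opnorm_continuous _ _ C) => w w'; exact: rC.
  apply: (@le_lt_trans _ _ C%:E); last exact: ltry.
  apply: Lip_le => *; [exact: ltW|exact: mdist_ge0|exact: rC].
apply: (@squeeze_cvge _ _ _ _ (cst 0%E) _ (fun s => (C * `|s - t|)%:E)).
- near=> s; rewrite cnorm_ge0/=; apply: cnorm_le => [|w].
    by rewrite mulr_ge0// ltW.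
  apply: rT => //.
  have : s \in `[0, 1] by near: s; exact: withinT.
  by rewrite in_itv.
- exact: cvg_cst.
- apply: cvg_EFin; first by near=> s.
  rewrite /comp/=; rewrite -(mulr0 C); apply: cvgM; first exact: cvg_cst.
  rewrite -(normr0 R) -(subrr t); apply: cvg_norm; apply: cvgB; last exact: cvg_cst.
  apply: cvg_within_filter; exact: cvg_id.
Unshelve. all: by end_near. Qed.

(** The spectral projections at the individual points and times are assembled by
    choice; uniqueness makes the choice immaterial. *)
Lemma exists_spectral_path (W : Type) (P0 P1 : W -> 'M[K]_n) (d : R) :
    projection P0 -> projection P1 -> 0 <= d < 1 ->
    (forall w, opnorm (P0 w - P1 w) <= d) ->
  exists P : R -> W -> 'M[K]_n, forall t w, 0 <= t <= 1 ->
    spectral_projection d (segment (P0 w) (P1 w) t) (P t w).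
Proof.
move=> P0P P1P /andP[d0 d1] Pd.
have ex (tw : R * W) : exists p, 0 <= tw.1 <= 1 ->
    spectral_projection d (segment (P0 tw.2) (P1 tw.2) tw.1) p.
  have [t01|t01] := boolP (0 <= tw.1 <= 1); last by exists 0.
  have [p pP] := exists_spectral_projection (P0P tw.2) (P1P tw.2) (Pd tw.2) d1 t01.
  by exists p.
have [f fP] := choice ex.
by exists (fun t w => f (t, w)) => t w t01; exact: (fP (t, w)).
Qed.

Lemma segment0 (p0 p1 : 'M[K]_n) : segment p0 p1 0 = p0.
Proof. by rewrite /segment subr0 rmorph1 rmorph0 scale1r scale0r addr0. Qed.

Lemma segment1 (p0 p1 : 'M[K]_n) : segment p0 p1 1 = p1.
Proof. by rewrite /segment subrr rmorph1 rmorph0 scale1r scale0r add0r. Qed.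

Lemma segment_const (p : 'M[K]_n) t : segment p p t = p.
Proof. by rewrite /segment -scalerDl -rmorphD subrK rmorph1 scale1r. Qed.

Lemma opnorm_segmentB_le (p0 p1 q0 q1 : 'M[K]_n) (t m : R) : 0 <= t <= 1 ->
    opnorm (p0 - q0) <= m -> opnorm (p1 - q1) <= m ->
  opnorm (segment p0 p1 t - segment q0 q1 t) <= m.
Proof.
move=> /andP[t0 t1] h0 h1; rewrite /segment opprD addrACA -!scalerBr.
apply: (le_trans (ler_opnormD _ _)); rewrite !opnormZ !scalar_abs_real.
rewrite !ger0_norm ?subr_ge0//.
by move: (opnorm (p0 - q0)) (opnorm (p1 - q1)) h0 h1 => x y h0 h1; nra.
Qed.

(** The two Lipschitz bounds come from [spectral_projection_lipschitz], applied to
    two places at the same time and to the same place at two times; the endpoints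
    and the last conclusion come from uniqueness, because a projection is its own
    spectral projection. *)
Lemma lipschitz_spectral_path (W : Type) (rho : W -> W -> R)
    (P0 P1 : W -> 'M[K]_n) (d L0 L1 : R) :
    is_metric rho -> projection P0 -> projection P1 -> 0 <= d < 1 ->
    (forall w, opnorm (P0 w - P1 w) <= d) ->
    Lip rho P0 = L0%:E -> Lip rho P1 = L1%:E ->
  exists P : R -> W -> 'M[K]_n,
  [/\ P 0 = P0, P 1 = P1,
    forall t : R, 0 <= t <= 1 -> projection (P t),
    forall (t : R) w w', 0 <= t <= 1 ->
      opnorm (P t w - P t w') <= (1 - d)^-1 * Num.max L0 L1 * rho w w' &
    (forall (s t : R) w, 0 <= s <= 1 -> 0 <= t <= 1 ->
      opnorm (P s w - P t w) <= (1 - d)^-1 * `|s - t|) /\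
    (forall (t : R) w, 0 <= t <= 1 -> P0 w = P1 w -> P t w = P0 w)].
Proof.
move=> rhoM P0P P1P d01 Pd L0E L1E.
have [P PP] := exists_spectral_path P0P P1P d01 Pd.
have [d0 d1] := andP d01.
have d'_gt0 : 0 < 1 - d by rewrite subr_gt0.
have P_const t w p : 0 <= t <= 1 -> segment (P0 w) (P1 w) t = p -> projector p ->
    P t w = p.
  move=> t01 <- pP; have := PP t w t01; move/(spectral_projection_unique d1); apply.
  exact: spectral_projection_id.
exists P; split.
- apply/funext => w; apply: P_const; [by rewrite lexx ler01|exact: segment0|exact: P0P].
- apply/funext => w; apply: P_const; [by rewrite lexx ler01|exact: segment1|exact: P1P].
- by move=> t t01 w; have [] := PP t w t01.
- move=> t w w' t01; rewrite -mulrA ler_pdivlMl//.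
  apply: le_trans (spectral_projection_lipschitz (PP t w t01) (PP t w' t01)) _.
  have rho0 : 0 <= rho w w' by case: rhoM.
  apply: opnorm_segmentB_le => //.
    by apply: (le_trans (opnorm_le_Lip w w' rhoM L0E)); rewrite ler_wpM2r// le_max lexx.
  by apply: (le_trans (opnorm_le_Lip w w' rhoM L1E)); rewrite ler_wpM2r// le_max lexx orbT.
- split=> [s t w s01 t01|t w t01 P01].
    rewrite ler_pdivlMl//.
    apply: le_trans (spectral_projection_lipschitz (PP s w s01) (PP t w t01)) _.
    rewrite segmentB opnormZ scalar_abs_real ler_piMr// opnormB.
    by apply: (le_trans (Pd w)); exact: ltW.
  by apply: P_const; [|rewrite -P01 segment_const|exact: P0P].
Qed.

End ProjectionPath.

(** * Metrics on a disjoint union *)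
Section Bridge.
Variables (R : realType) (k : scalar_kind) (n : nat).
Local Notation K := (scalar_type R k).
Variables (X Y : metricType R) (rho : X + Y -> X + Y -> R) (eps : R).
Hypothesis rho_metric : is_metric rho.
Hypothesis rhoX : forall x x' : X, rho (inl x) (inl x') = mdist x x'.
Hypothesis rhoY : forall y y' : Y, rho (inr y) (inr y') = mdist y y'.

Lemma hausdorff_close : (hausdorff_dist rho (range inl) (range inr) < eps%:E)%E ->
  [/\ 0 < eps, forall x, exists y, rho (inl x) (inr y) <= eps &
      forall y, exists x, rho (inr y) (inl x) <= eps].
Proof.
case: rho_metric => _ _ rho_sym _.
move=> /ereal_inf_lt[_ [r [r0 Xr Yr] <-]]; rewrite lte_fin => reps.
split=> [|x|y]; first exact: lt_trans reps.
  have [|_ [y _ <-] xy] := Xr (inl x); first by exists x.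
  by exists y; rewrite rho_sym ltW// (lt_trans xy).
have [|_ [x _ <-] xy] := Yr (inr y); first by exists y.
by exists x; rewrite rho_sym ltW// (lt_trans xy).
Qed.

(** From [z'] to [z] each of the two functions moves by at most [eps] times its
    Lipschitz constant. *)
Lemma opnormB_le_near (P0 P1 : X + Y -> 'M[K]_n) (L0 L1 : R) z z' :
    Lip rho P0 = L0%:E -> Lip rho P1 = L1%:E -> rho z z' <= eps ->
  opnorm (P0 z - P1 z) <= opnorm (P0 z' - P1 z') + eps * (L0 + L1).
Proof.
move=> L0E L1E zz'.
have L0_ge0 : 0 <= L0 by rewrite -lee_fin -L0E Lip_ge0.
have L1_ge0 : 0 <= L1 by rewrite -lee_fin -L1E Lip_ge0.
have h0 := opnorm_le_Lip z z' rho_metric L0E.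
have h1 := opnorm_le_Lip z z' rho_metric L1E.
have -> : P0 z - P1 z = (P0 z' - P1 z') + ((P0 z - P0 z') - (P1 z - P1 z')).
  by move: (P0 z) (P0 z') (P1 z) (P1 z') => a b c e; entrywise.
apply: (le_trans (ler_opnormD _ _)); rewrite lerD2l.
apply: (le_trans (ler_opnormB _ _)); rewrite mulrDr; apply: lerD.
  by apply: (le_trans h0); rewrite mulrC ler_wpM2r.
by apply: (le_trans h1); rewrite mulrC ler_wpM2r.
Qed.

Lemma dsum_projection (p : X -> 'M[K]_n) (q : Y -> 'M[K]_n) :
  projection p -> projection q -> projection (dsum p q).
Proof. by move=> pP qP [x|y] /=; [exact: pP|exact: qP]. Qed.

(** The common core of all the parts: the path over the disjoint union is cut into
    its two pieces, and a piece whose ends coincide does not move. *)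
Lemma dsum_path (p0 p1 : X -> 'M[K]_n) (q0 q1 : Y -> 'M[K]_n) (d L0 L1 : R) :
    projection p0 -> projection p1 -> projection q0 -> projection q1 ->
    0 <= d < 1 ->
    (forall x, opnorm (p0 x - p1 x) <= d) -> (forall y, opnorm (q0 y - q1 y) <= d) ->
    Lip rho (dsum p0 q0) = L0%:E -> Lip rho (dsum p1 q1) = L1%:E ->
  exists (pt : R -> X -> 'M[K]_n) (qt : R -> Y -> 'M[K]_n),
  [/\ projection_path pt p0 p1, projection_path qt q0 q1,
    forall t : R, 0 <= t <= 1 ->
      (Lip rho (dsum (pt t) (qt t)) <=
       (1 - d%:E)^-1 * maxe (Lip rho (dsum p0 q0)) (Lip rho (dsum p1 q1)))%E,
    forall t : R, 0 <= t <= 1 -> p0 = p1 -> pt t = p0 &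
    forall t : R, 0 <= t <= 1 -> q0 = q1 -> qt t = q0].
Proof.
move=> p0P p1P q0P q1P d01 pd qd L0E L1E.
have [d0 d1] := andP d01; have d'_gt0 : 0 < 1 - d by rewrite subr_gt0.
have Pd z : opnorm (dsum p0 q0 z - dsum p1 q1 z) <= d by case: z => [x|y] /=.
have [P [P0E P1E PP PL [PT PC]]] := lipschitz_spectral_path rho_metric
  (dsum_projection p0P q0P) (dsum_projection p1P q1P) d01 Pd L0E L1E.
have L0_ge0 : 0 <= L0 by rewrite -lee_fin -L0E Lip_ge0.
set M := (1 - d)^-1 * Num.max L0 L1 in PL.
have M_ge0 : 0 <= M by rewrite mulr_ge0 ?invr_ge0 ?le_max ?L0_ge0// ltW.
(* One constant that serves both in space and in time. *)
pose C := M + (1 - d)^-1.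
have MC : M <= C by rewrite lerDl invr_ge0 ltW.
have dC : (1 - d)^-1 <= C by rewrite lerDr.
have path (W : metricType R) (j : W -> X + Y)
    (jE : forall w w', rho (j w) (j w') = mdist w w') :
    projection_path (fun t w => P t (j w)) (fun w => P 0 (j w)) (fun w => P 1 (j w)).
  apply: (@lipschitz_projection_path _ _ _ _ _ C) => [t t01 w|t w w' t01|s t w s01 t01].
  - exact: PP.
  - apply: (le_trans (PL _ _ _ t01)); rewrite jE.
    by apply: ler_wpM2r => //; exact: mdist_ge0.
  - by apply: (le_trans (PT _ _ _ s01 t01)); exact: ler_wpM2r.
exists (fun t x => P t (inl x)), (fun t y => P t (inr y)); split.
- by have := path _ _ rhoX; rewrite P0E P1E.
- by have := path _ _ rhoY; rewrite P0E P1E.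
- move=> t t01; rewrite L0E L1E -EFin_max -EFinB inver gt_eqF// -EFinM -/M.
  apply: Lip_le => //; first by case: rho_metric.
  by move=> [x|y] [x'|y'] /=; exact: PL.
- by move=> t t01 p01; apply/funext => x; rewrite (PC t (inl x))//= p01.
- by move=> t t01 q01; apply/funext => y; rewrite (PC t (inr y))//= q01.
Qed.

End Bridge.

Theorem theorem4p5 (R : realType) (k : scalar_kind) (X Y : metricType R)
    (rho : X + Y -> X + Y -> R) (eps : R) (n : nat)
    (cptX : compact [set: X]) (cptY : compact [set: Y])
    (rho_metric : is_metric rho)
    (rhoX : forall x x' : X, rho (inl x) (inl x') = mdist x x')
    (rhoY : forall y y' : Y, rho (inr y) (inr y') = mdist y y')
    (rho_eps : (hausdorff_dist rho (range inl) (range inr) < eps%:E)%E)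
    (n_gt0 : (0 < n)%N) :
  (* (a) *)
  (forall (p : X -> 'M[scalar_type R k]_n) (q : Y -> 'M[scalar_type R k]_n),
    lipschitz_projection p -> lipschitz_projection q ->
    (eps%:E * Lip rho (dsum p q) < (1 / 2)%:E)%E ->
    (forall q1 : Y -> 'M[scalar_type R k]_n,
      lipschitz_projection q1 ->
      (eps%:E * Lip rho (dsum p q1) < (1 / 2)%:E)%E ->
      let delta := (eps%:E * (Lip rho (dsum p q) + Lip rho (dsum p q1)))%E in
      exists qt : R -> Y -> 'M[scalar_type R k]_n,
        projection_path qt q q1 /\
        forall t : R, 0 <= t <= 1 ->
          (Lip rho (dsum p (qt t)) <=
           (1 - delta)^-1 * maxe (Lip rho (dsum p q)) (Lip rho (dsum p q1)))%E)
    /\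
    (forall p1 : X -> 'M[scalar_type R k]_n,
      lipschitz_projection p1 ->
      (eps%:E * Lip rho (dsum p1 q) < (1 / 2)%:E)%E ->
      let delta' := (eps%:E * (Lip rho (dsum p q) + Lip rho (dsum p1 q)))%E in
      exists pt : R -> X -> 'M[scalar_type R k]_n,
        projection_path pt p p1 /\
        forall t : R, 0 <= t <= 1 ->
          (Lip rho (dsum (pt t) q) <=
           (1 - delta')^-1 *
             maxe (Lip rho (dsum p q)) (Lip rho (dsum p1 q)))%E))
  /\
  (* (b) *)
  (forall (p0 p1 : X -> 'M[scalar_type R k]_n) (q0 q1 : Y -> 'M[scalar_type R k]_n),
    lipschitz_projection p0 -> lipschitz_projection p1 ->
    lipschitz_projection q0 -> lipschitz_projection q1 ->
    let delta := (cnorm (p0 \- p1)%R +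
      eps%:E * (Lip rho (dsum p0 q0) + Lip rho (dsum p1 q1)))%E in
    (delta < 1)%E ->
    exists (pt : R -> X -> 'M[scalar_type R k]_n) (qt : R -> Y -> 'M[scalar_type R k]_n),
      [/\ projection_path pt p0 p1, projection_path qt q0 q1 &
        forall t : R, 0 <= t <= 1 ->
          (Lip rho (dsum (pt t) (qt t)) <=
           (1 - delta)^-1 *
             maxe (Lip rho (dsum p0 q0)) (Lip rho (dsum p1 q1)))%E]).
Proof.
have [eps_gt0 nearX nearY] := hausdorff_close rho_metric rho_eps.
have Lip_fin p q (c : \bar R) :
    (eps%:E * @Lip R k n _ rho (dsum p q) <= c)%E -> (c < +oo)%E ->
    exists2 L : R, Lip rho (dsum p q) = L%:E & 0 <= L.
  move: (Lip_ge0 rho (dsum p q)); case: Lip => [L|//|] //=.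
    by move=> L0 _ _; exists L.
  by move=> _; rewrite gt0_muley ?lte_fin// leye_eq => /eqP ->.
split=> [p q [_ _ pP] [_ _ qP] pq|p0 p1 q0 q1 [_ _ p0P] [_ _ p1P] [_ _ q0P] [_ _ q1P]].
  have [L LE L_ge0] := Lip_fin _ _ _ (ltW pq) (ltry _).
  rewrite LE -EFinM lte_fin in pq.
  have self_dist (W : Type) (a : W -> 'M[scalar_type R k]_n) (w : W) : opnorm (a w - a w) = 0.
    by rewrite subrr opnorm0.
  split=> [q1 [_ _ q1P]|p1 [_ _ p1P]] pq1.
    have [L1 L1E L1_ge0] := Lip_fin _ _ _ (ltW pq1) (ltry _).
    rewrite L1E -EFinM lte_fin in pq1.
    have d01 : 0 <= eps * (L + L1) < 1.
      by rewrite mulr_ge0 ?addr_ge0 ?(ltW eps_gt0)//=; lra.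
    have [|y|pt [qt [_ qtP qtL ptC _]]] :=
      dsum_path rho_metric rhoX rhoY pP pP qP q1P d01 _ _ LE L1E.
    - by move=> x; rewrite self_dist; case/andP: d01.
    - have [x yx] := nearY y.
      by have := opnormB_le_near rho_metric LE L1E yx; rewrite /= self_dist add0r.
    exists qt; split=> // t t01.
    have := qtL t t01; rewrite ptC// => /le_trans; apply.
    by rewrite LE L1E.
  have [L1 L1E L1_ge0] := Lip_fin _ _ _ (ltW pq1) (ltry _).
  rewrite L1E -EFinM lte_fin in pq1.
  have d01 : 0 <= eps * (L + L1) < 1.
    by rewrite mulr_ge0 ?addr_ge0 ?(ltW eps_gt0)//=; lra.
  have [x|y|pt [qt [ptP _ ptL _ qtC]]] :=
    dsum_path rho_metric rhoX rhoY pP p1P qP qP d01 _ _ LE L1E.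
  - have [y xy] := nearX x.
    by have := opnormB_le_near rho_metric LE L1E xy; rewrite /= self_dist add0r.
  - by rewrite self_dist; case/andP: d01.
  exists pt; split=> // t t01.
  have := ptL t t01; rewrite qtC// => /le_trans; apply.
  by rewrite LE L1E.
move=> delta delta1.
have cn0 := cnorm_ge0 (p0 \- p1)%R.
have le_delta (p : X -> 'M[scalar_type R k]_n) (q : Y -> 'M[scalar_type R k]_n) :
    (Lip rho (dsum p q) <= Lip rho (dsum p0 q0) + Lip rho (dsum p1 q1))%E ->
    (eps%:E * Lip rho (dsum p q) <= delta)%E.
  move=> le; apply: (@le_trans _ _ (eps%:E * (Lip rho (dsum p0 q0) + Lip rho (dsum p1 q1)))%E).
    by apply: lee_wpmul2l => //; rewrite lee_fin ltW.
  by rewrite /delta leeDr.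
have delta_lty : (delta < +oo)%E by apply: lt_trans delta1 _; exact: ltry.
have [|L0 L0E L0_ge0] := Lip_fin p0 q0 _ _ delta_lty.
  by apply: le_delta; rewrite leeDl// Lip_ge0.
have [|L1 L1E L1_ge0] := Lip_fin p1 q1 _ _ delta_lty.
  by apply: le_delta; rewrite leeDr// Lip_ge0.
have opnorm_cnorm x := opnorm_le_cnorm (p0 \- p1)%R x.
have [c cE] : exists c, cnorm (p0 \- p1)%R = c%:E.
  move: cn0 delta_lty; rewrite /delta L0E L1E -EFinD -EFinM.
  by case: cnorm => [c|//|//] _ _; exists c.
have c_ge0 : 0 <= c by rewrite -lee_fin -cE.
have pc x : opnorm (p0 x - p1 x) <= c by rewrite -lee_fin -cE; exact: opnorm_cnorm.
have dE : delta = (c + eps * (L0 + L1))%:E.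
  by rewrite /delta cE L0E L1E.
have eL_ge0 : 0 <= eps * (L0 + L1) by rewrite mulr_ge0 ?addr_ge0// ltW.
have d01 : 0 <= c + eps * (L0 + L1) < 1.
  by rewrite addr_ge0//= -lte_fin -dE.
have [x|y|pt [qt [ptP qtP ptL _ _]]] :=
  dsum_path rho_metric rhoX rhoY p0P p1P q0P q1P d01 _ _ L0E L1E.
- by apply: (le_trans (pc x)); rewrite lerDl.
- have [x yx] := nearY y.
  apply: (le_trans (opnormB_le_near rho_metric L0E L1E yx)).
  by rewrite lerD2r; exact: pc.
by exists pt, qt; split=> // t t01; rewrite dE; exact: ptL.
Qed.
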